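(* Let $S=\langle x_1,x_2,x_3,x_4 \mid R\rangle$ be the semigroup with zero presented by generators $x_1,x_2,x_3,x_4$ and the following relations $R$: $x_ix_jx_k=0$ for all $i,j,k\in\{1,2,3,4\}$; $x_1^2=x_4x_1$; $x_4^2=x_1x_4$; and $$x_1x_2=x_4x_2=x_1x_3=x_4x_3=x_2x_1=x_2x_3=x_3x_2=x_3x_4=0 .$$ Then $S$ has knit degree $3$.
   Context: For a semigroup $S$, $Z(S)$ denotes its center, i.e. the set of elements commuting with every element of $S$. The commuting graph $\Gamma(S)$ is the simple graph with vertex set $S\setminus Z(S)$ in which two distinct vertices are joined by an edge if and only if they commute in $S$. A path $a_1-a_2-\dots-a_m$ in $\Gamma(S)$ is called a left path if $a_1\neq a_m$ and $a_1a_i=a_ma_i$ for every $1\le i\le m$. The length of a path is its number of edges (so the path above has length $m-1$). If $\Gamma(S)$ contains a left path, the knit degree of $S$ is the length of a shortest left path in $\Gamma(S)$. The presentation is taken in the category of semigroups with zero (a quotient of the free semigroup with a zero adjoined, without identity). *)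

(* Defs.v *)
From HB Require Import structures.
From mathcomp Require Import all_boot.
From mathcomp Require Import boolp classical_sets.

Set Implicit Arguments.
Unset Strict Implicit.
Unset Printing Implicit Defensive.

Local Open Scope group_scope.

(* The pair (a, w) stands for the nonempty word a :: w. *)
Definition free_semigroup (X : Type) : Type := (X * seq X)%type.

Section FreeSemigroup.
Variable X : choiceType.

HB.instance Definition _ := Choice.on (free_semigroup X).

Definition free_mul (u v : free_semigroup X) : free_semigroup X :=
  (u.1, u.2 ++ v.1 :: v.2).

Lemma free_mulA : associative free_mul.
Proof. by move=> u v w; rewrite /free_mul /= -catA. Qed.

HB.instance Definition _ := isSemigroup.Build (free_semigroup X) free_mulA.

End FreeSemigroup.

Definition with_zero (S : Type) : Type := option S.

Section WithZero.
Variable S : semigroupType.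

HB.instance Definition _ := Choice.on (with_zero S).

Definition with_zero_mul (a b : with_zero S) : with_zero S :=
  if a is Some u then if b is Some v then Some (u * v) else None else None.

Lemma with_zero_mulA : associative with_zero_mul.
Proof. by case=> [u|] [v|] [w|] //=; rewrite mulgA. Qed.

HB.instance Definition _ := isSemigroup.Build (with_zero S) with_zero_mulA.

End WithZero.

Section Quotient.
Variables (S : semigroupType) (R : S -> S -> Prop).

Inductive generated_congruence : S -> S -> Prop :=
| GC_rel a b of R a b : generated_congruence a b
| GC_refl a : generated_congruence a a
| GC_sym a b of generated_congruence a b : generated_congruence b a
| GC_trans a b c of generated_congruence a b & generated_congruence b c :
    generated_congruence a c
| GC_mul a b c d of generated_congruence a b & generated_congruence c d :
    generated_congruence (a * c) (b * d).

Definition congruence_rel : rel S := fun a b => `[< generated_congruence a b >].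

Lemma congruence_refl : reflexive congruence_rel.
Proof. by move=> a; apply/asboolP; apply: GC_refl. Qed.

Lemma congruence_sym : symmetric congruence_rel.
Proof. by move=> a b; apply/asboolP/asboolP; apply: GC_sym. Qed.

Lemma congruence_trans : transitive congruence_rel.
Proof.
by move=> b a c /asboolP ab /asboolP bc; apply/asboolP; apply: GC_trans ab bc.
Qed.

Canonical congruence_equiv :=
  EquivRel congruence_rel congruence_refl congruence_sym congruence_trans.

Local Open Scope quotient_scope.

Definition quotient_semigroup : Type := {eq_quot congruence_rel}.
HB.instance Definition _ := EqQuotient.on quotient_semigroup.
HB.instance Definition _ := Choice.on quotient_semigroup.

Lemma quotient_eqP (a b : S) :
  \pi_quotient_semigroup a = \pi_quotient_semigroup b <->
  generated_congruence a b.
Proof.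
split=> [/eqmodP/asboolP //|ab]; apply/eqmodP; exact/asboolP.
Qed.

Definition quotient_mul (p q : quotient_semigroup) : quotient_semigroup :=
  \pi_quotient_semigroup (repr p * repr q).

Lemma quotient_mul_pi (a b : S) :
  quotient_mul (\pi_quotient_semigroup a) (\pi_quotient_semigroup b) =
  \pi_quotient_semigroup (a * b).
Proof.
by apply/quotient_eqP; apply: GC_mul; apply/quotient_eqP; rewrite reprK.
Qed.

Lemma quotient_mulA : associative quotient_mul.
Proof.
elim/quotW=> a; elim/quotW=> b; elim/quotW=> c.
rewrite (quotient_mul_pi b c) (quotient_mul_pi a b).
by rewrite (quotient_mul_pi a (b * c)) (quotient_mul_pi (a * b) c) mulgA.
Qed.

HB.instance Definition _ := isSemigroup.Build quotient_semigroup quotient_mulA.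

End Quotient.

Definition free_with_zero (X : choiceType) : semigroupType :=
  with_zero (free_semigroup X).

Definition fz_gen (X : choiceType) (x : X) : free_with_zero X := Some (x, [::]).

Definition fz_zero (X : choiceType) : free_with_zero X := None.

Definition presented_semigroup (X : choiceType)
    (R : free_with_zero X -> free_with_zero X -> Prop) : semigroupType :=
  quotient_semigroup R.

Section CommutingGraph.
Variable S : semigroupType.

Definition center : set S := [set z | forall s, commute z s]%classic.

Definition commuting_vertex : pred S := fun a => `[< ~ center a >].

Definition commuting_edge : rel S := fun a b =>
  [&& commuting_vertex a, commuting_vertex b, a != b & `[< commute a b >]].

(* The sequence a :: p is a path from a to last a p, of length size p. *)
Definition commuting_path (a : S) (p : seq S) : bool :=
  [&& all commuting_vertex (a :: p), path commuting_edge a p & uniq (a :: p)].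

Definition left_path (a : S) (p : seq S) : Prop :=
  [/\ commuting_path a p, a != last a p &
      forall b, b \in a :: p -> a * b = last a p * b].

(* In particular, some left path exists. *)
Definition knit_degree_is (n : nat) : Prop :=
  (exists a p, left_path a p /\ size p = n) /\
  (forall a p, left_path a p -> n <= size p).

End CommutingGraph.

Notation F4 := (free_with_zero 'I_4).

Definition x1 : F4 := fz_gen (@Ordinal 4 0 isT).
Definition x2 : F4 := fz_gen (@Ordinal 4 1 isT).
Definition x3 : F4 := fz_gen (@Ordinal 4 2 isT).
Definition x4 : F4 := fz_gen (@Ordinal 4 3 isT).

Definition zero_products : seq F4 :=
  [:: x1 * x2; x4 * x2; x1 * x3; x4 * x3;
      x2 * x1; x2 * x3; x3 * x2; x3 * x4].

Inductive relations : F4 -> F4 -> Prop :=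
| rel_cube (i j k : 'I_4) :
    relations (fz_gen i * fz_gen j * fz_gen k) (fz_zero 'I_4)
| rel_11 : relations (x1 * x1) (x4 * x1)
| rel_44 : relations (x4 * x4) (x1 * x4)
| rel_zero w of w \in zero_products : relations w (fz_zero 'I_4).

(* Main.v *)
From mathcomp Require Import all_boot.
From mathcomp Require Import boolp.
Require Import Defs.

Set Implicit Arguments.
Unset Strict Implicit.
Unset Printing Implicit Defensive.

Local Open Scope group_scope.
Local Open Scope quotient_scope.

(** Words of length at least 3 vanish, so the semigroup is determined by its
    table of products of two generators; [normal_form] reads that table off, and
    [presented_eqP] says that two words are equal in the semigroup exactly when
    their normal forms agree.  Every question below is thereby a finite
    computation with letters.

    Everything but the four generators is central ([vertex_is_generator]).  From
    the table, the commuting pairs of distinct generators are 12, 23 and 34, so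
    the commuting graph is the path x1 - x2 - x3 - x4.  A left path from [a] to
    [b] satisfies [a a = b a]; for distinct generators this happens only for
    {a, b} = {x1, x4} ([left_path_endpoints]), and these two vertices are at
    distance 3 in the graph ([endpoints_far]).  The whole graph is itself a left
    path, since [x1 y = x4 y] for every generator [y]. *)

(** The values 0, ..., 3 stand for the letters x1, ..., x4.  The common value
    of x1 x1 and x4 x1 is written x4 x1, and that of x4 x4 and x1 x4 is written
    x1 x4. *)
Definition product_table (i j : 'I_4) : F4 :=
  match val i, val j with
  | 0, 0 | 3, 0 => x4 * x1
  | 0, 3 | 3, 3 => x1 * x4
  | 1, 1 | 1, 3 | 2, 0 | 2, 2 => fz_gen i * fz_gen j
  | _, _ => fz_zero 'I_4
  end.

Definition normal_form (w : F4) : F4 :=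
  match w with
  | Some (i, [::]) => fz_gen i
  | Some (i, [:: j]) => product_table i j
  | _ => fz_zero 'I_4
  end.

Lemma ord4P (P : 'I_4 -> Prop) :
  P (@Ordinal 4 0 isT) -> P (@Ordinal 4 1 isT) ->
  P (@Ordinal 4 2 isT) -> P (@Ordinal 4 3 isT) -> forall i, P i.
Proof.
move=> P0 P1 P2 P3 [[|[|[|[|n]]]] lt_n] //.
- by rewrite (bool_irrelevance lt_n isT).
- by rewrite (bool_irrelevance lt_n isT).
- by rewrite (bool_irrelevance lt_n isT).
- by rewrite (bool_irrelevance lt_n isT).
Qed.

Lemma product_table_shape (i j : 'I_4) :
  product_table i j = fz_zero 'I_4 \/
  exists k l, product_table i j = fz_gen k * fz_gen l.
Proof.
by elim/ord4P: i; elim/ord4P: j; (by left) || (right; do 2!eexists; reflexivity).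
Qed.

(** The normal form of a word of length at least 2 is zero or again of length 2,
    so a product of three or more letters still has normal form zero after its
    factors have been normalised. *)
Lemma normal_formM (u v : F4) :
  normal_form (u * v) = normal_form (normal_form u * normal_form v).
Proof.
case: u => [[i [|j [|k s]]]|]; case: v => [[i' [|j' [|k' s']]]|] //=.
- by case: (product_table_shape i' j') => [->|[k [l ->]]].
- by case: (product_table_shape i j) => [->|[k [l ->]]].
- case: (product_table_shape i j) => [->|[k [l ->]]] //.
  by case: (product_table_shape i' j') => [->|[k' [l' ->]]].
- by case: (product_table_shape i j) => [->|[k [l ->]]].
- by case: (product_table_shape i j) => [->|[k [l ->]]].
Qed.

Lemma normal_form_congruence (u v : F4) :
  generated_congruence relations u v -> normal_form u = normal_form v.
Proof.
elim=> {u v} [u v [i j k|||w]|u|u v _ ->|u v w _ -> _ ->|a b c d _ ab _ cd] //.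
- rewrite !inE.
  by do 7![case/orP=> [/eqP->|] //]; move/eqP->.
- by rewrite normal_formM ab cd -normal_formM.
Qed.

Lemma long_word_zero (i j k : 'I_4) (s : seq 'I_4) :
  generated_congruence relations (Some (i, [:: j, k & s])) (fz_zero 'I_4).
Proof.
have ijk0 := GC_rel (rel_cube i j k).
case: s => [|l s]; first exact: ijk0.
exact: (GC_mul ijk0 (GC_refl relations (Some (l, s)))).
Qed.

Lemma congruence_normal_form (w : F4) :
  generated_congruence relations w (normal_form w).
Proof.
case: w => [[i [|j [|k s]]]|] /=; try exact: GC_refl; last exact: long_word_zero.
have zero w : w \in zero_products ->
    generated_congruence relations w (fz_zero 'I_4).
  by move=> w0; apply: GC_rel; apply: rel_zero.
elim/ord4P: i; elim/ord4P: j;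
  (exact: GC_refl) || (exact: GC_rel rel_11) || (exact: GC_rel rel_44) ||
  exact: zero.
Qed.

Local Notation S := (presented_semigroup relations).

Definition word_class (w : F4) : S := \pi_(quotient_semigroup relations) w.

Definition generator (i : 'I_4) : S := word_class (fz_gen i).

Lemma word_classM (u v : F4) : word_class u * word_class v = word_class (u * v).
Proof. exact: quotient_mul_pi. Qed.

Lemma presented_eqP (u v : F4) :
  word_class u = word_class v <-> normal_form u = normal_form v.
Proof.
split=> [/quotient_eqP/normal_form_congruence //|uv].
apply/quotient_eqP; apply: GC_trans (congruence_normal_form u) _.
rewrite uv; exact/GC_sym/congruence_normal_form.
Qed.

Lemma generatorM_eqP (i j k l : 'I_4) :
  generator i * generator j = generator k * generator l <->
  product_table i j = product_table k l.
Proof. by rewrite /generator !word_classM; apply: presented_eqP. Qed.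

Lemma generator_inj : injective generator.
Proof. by move=> i j /presented_eqP []. Qed.

Lemma vertex_is_generator (a : S) :
  commuting_vertex a -> exists i, a = generator i.
Proof.
move=> /asboolP noncentral_a; move: noncentral_a.
elim/quotW: a => -[[i [|j s]]|] noncentral; first by exists i.
- case: noncentral; elim/quotW=> v; rewrite /commute.
  rewrite [LHS](word_classM (Some (i, j :: s)) v).
  rewrite [RHS](word_classM v (Some (i, j :: s))).
  apply/presented_eqP; case: v => [[k t]|] //=.
  by case: s => [|? ?]; case: t => [|? [|? ?]].
- case: noncentral; elim/quotW=> v; rewrite /commute.
  rewrite [LHS](word_classM None v) [RHS](word_classM v None).
  by case: v.
Qed.

Lemma generator_noncentral (i : 'I_4) : commuting_vertex (generator i).
Proof.
apply/asboolP=> central_i.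
(* A letter not commuting with i: 4 for 1 and 2, and 1 for 3 and 4. *)
have := central_i (generator (if val i < 2 then @Ordinal 4 3 isT
                              else @Ordinal 4 0 isT)).
by move=> /generatorM_eqP; elim/ord4P: i {central_i}.
Qed.

Lemma commuting_edgeP (i j : 'I_4) :
  commuting_edge (generator i) (generator j) <->
  i != j /\ product_table i j = product_table j i.
Proof.
rewrite /commuting_edge !generator_noncentral (inj_eq generator_inj) /=.
split=> [/andP[-> /asboolP /generatorM_eqP] //|[-> ij]] /=.
by apply/asboolP/generatorM_eqP.
Qed.

(** The positions of x1 and x4, in either order: the two ends of the commuting
    graph. *)
Definition extremal_pair (i j : 'I_4) : bool :=
  [|| (val i == 0) && (val j == 3) | (val i == 3) && (val j == 0)].

(** The squares x2 x2 and x3 x3 occur once in the product table, and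
    the squares of x1 and x4 occur once more in their columns, in the row of
    the other. *)
Lemma left_path_endpoints (i j : 'I_4) :
  i != j -> product_table i i = product_table j i -> extremal_pair i j.
Proof. by elim/ord4P: i; elim/ord4P: j. Qed.

(** The only neighbour of x1 is x2, and the only one of x4 is x3. *)
Lemma endpoints_far (i j : 'I_4) (p : seq S) :
  extremal_pair i j -> path (@commuting_edge S) (generator i) p ->
  last (generator i) p = generator j -> 2 < size p.
Proof.
case: p => [|a [|b [|c p]]] //= ij.
- by move=> _ /generator_inj eq_ij; move: ij; rewrite eq_ij; elim/ord4P: j {eq_ij}.
- move=> /andP[edge _] a_j; move: edge; rewrite a_j => /commuting_edgeP[_].
  by move: ij; elim/ord4P: i; elim/ord4P: j {a_j}.
- move=> /and3P[edge_a edge_b _] b_j; move: edge_a edge_b; rewrite b_j.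
  move=> edge_a; have /and4P[_ vertex_a _ _] := edge_a; move: edge_a.
  have [k ->] := vertex_is_generator vertex_a.
  move=> /commuting_edgeP[ik com_ik] /commuting_edgeP[kj com_kj].
  by move: ij ik com_ik kj com_kj; elim/ord4P: i; elim/ord4P: j {b_j} => //;
    elim/ord4P: k.
Qed.

Lemma left_path_size (a : S) (p : seq S) : left_path a p -> 2 < size p.
Proof.
case=> /and3P[/allP vertices path_p _] a_neq_last a_eq_last.
have [i a_i] := vertex_is_generator (vertices a (mem_head a p)).
have [j last_j] := vertex_is_generator (vertices _ (mem_last a p)).
move: (a_eq_last a (mem_head a p)) a_neq_last path_p.
rewrite last_j a_i (inj_eq generator_inj).
move=> /generatorM_eqP ii_ji i_neq_j path_p.
apply: endpoints_far (left_path_endpoints i_neq_j ii_ji) path_p _.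
by rewrite -a_i.
Qed.

Lemma generators_left_path :
  left_path (generator (@Ordinal 4 0 isT))
    (map generator [:: @Ordinal 4 1 isT; @Ordinal 4 2 isT; @Ordinal 4 3 isT]).
Proof.
split.
- apply/and3P; split; first by rewrite /= !generator_noncentral.
    by rewrite /=; apply/and4P; split=> //; apply/commuting_edgeP.
  by rewrite -map_cons (map_inj_uniq generator_inj).
- by rewrite /= (inj_eq generator_inj).
- move=> b; rewrite -map_cons => /mapP[i _ ->] /=.
  by apply/generatorM_eqP; elim/ord4P: i.
Qed.

Theorem mainTheorem4 : knit_degree_is (presented_semigroup relations) 3.
Proof.
split; last exact: left_path_size.
by eexists; eexists; split; first exact: generators_left_path.
Qed.
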